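(* Consider a family of systems $\dot x=f(x,p)$, $x\in\mathbb{R}^n$, with a vector of parameters $p$ taking values in a set $\mathcal{P}\subset\mathbb{R}^m$, where $f$ is continuous in $(x,p)$ and twice continuously differentiable in $x$ for every fixed $p$. Suppose that for every $p\in\mathcal{P}$ the system $\dot x=f(x,p)$ has two asymptotically stable fixed points $x^\ast(p)$ and $x^\bullet(p)$ in $\mathcal{D}_{f(\cdot,p)}$, where $\mathcal{D}_{f(\cdot,p)}=\mathrm{cl}(\mathcal{B}(x^\ast(p))\cup\mathcal{B}(x^\bullet(p)))$, and that $x^\bullet(p)\succeq x^\ast(p)$. Let $\mathcal{D}=\mathcal{D}_{f(\cdot,q)}$ for all $q\in\mathcal{P}$, and let the systems $\dot x=f(x,p)$ be monotone on $\mathcal{D}\times\mathcal{P}$. Consider an interval $[p_{\min},p_{\max}]\subseteq\mathcal{P}$ such that $$x^\ast(p_{\min})\in\mathcal{B}(x^\ast(p_{\max})),\qquad x^\ast(p_{\max})\in\mathcal{B}(x^\ast(p_{\min})),$$ $$x^\bullet(p_{\min})\notin[x^\ast(p_{\min}),x^\ast(p_{\max})].$$ Then $$\mathcal{B}(x^\ast(p_{\min}))\supseteq\mathcal{B}(x^\ast(p))\supseteq\mathcal{B}(x^\ast(p_{\max}))$$ for all $p\in[p_{\min},p_{\max}]$. Moreover, the sets $\mathcal{B}(x^\ast(p))$ are order-convex for all $p\in[p_{\min},p_{\max}]$.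
   Context: Partial order on $\mathbb{R}^N$ (for $N=n$ and $N=m$): $x\succeq y$ iff $x-y\in\mathbb{R}^N_{\ge 0}$. $[x,y]=\{z : x\preceq z\preceq y\}$. A set $\mathcal{A}$ is order-convex if for all $x,y\in\mathcal{A}$ the closed interval $[x,y]$ is a subset of $\mathcal{A}$. $\phi_f(t,x,p)$ denotes the solution at time $t$ of $\dot x=f(x,p)$ with initial condition $x$. The basin of attraction is $\mathcal{B}(x^\ast(p))=\{x\in\mathbb{R}^n:\lim_{t\to\infty}\phi_f(t,x,p)=x^\ast(p)\}$, and similarly for $x^\bullet(p)$. The system is monotone on $\mathcal{D}\times\mathcal{P}$ if $\phi_f(t,x,p)\preceq\phi_f(t,y,q)$ for all $t\ge 0$ and all $x\preceq y$, $p\preceq q$ with $x,y\in\mathcal{D}$, $p,q\in\mathcal{P}$. $\mathrm{cl}$ denotes closure. Standing assumption: for every stable fixed point considered, the Jacobian matrix of the vector field there is diagonalizable. *)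

(* Defs.v *)
(* R^N is 'rV[R]_N, over an arbitrary R : realType. *)
From HB Require Import structures.
From mathcomp Require Import all_boot all_order all_algebra.
From mathcomp Require Import all_classical all_reals all_analysis.
From mathcomp.real_closed Require Import complex.

Set Implicit Arguments.
Unset Strict Implicit.
Unset Printing Implicit Defensive.

Import Order.TTheory GRing.Theory Num.Theory.
Import numFieldNormedType.Exports.

Local Open Scope classical_set_scope.
Local Open Scope ring_scope.

Definition vle (R : realType) (N : nat) (x y : 'rV[R]_N) : Prop :=
  forall i : 'I_N, x ord0 i <= y ord0 i.

Definition vitv (R : realType) (N : nat) (x y : 'rV[R]_N) : set 'rV[R]_N :=
  [set z | vle x z /\ vle z y].

Definition order_convex (R : realType) (N : nat) (A : set 'rV[R]_N) : Prop :=
  forall x y : 'rV[R]_N, A x -> A y -> vitv x y `<=` A.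

Definition C1 (R : realType) (n : nat) (g : 'rV[R]_n -> 'rV[R]_n) : Prop :=
  (forall x, differentiable g x) /\ (forall v, continuous ('D_v g)).

Definition C2 (R : realType) (n : nat) (g : 'rV[R]_n -> 'rV[R]_n) : Prop :=
  C1 g /\ (forall v, C1 ('D_v g)).

(* u solves x' = g(x), u(0) = x, on the time interval I.  The derivative is
   only required in the interior of I; as u is continuous on I and g is
   continuous, the one-sided equations at the end points of I follow. *)
Definition is_solution (R : realType) (n : nat) (g : 'rV[R]_n -> 'rV[R]_n)
    (I : set R) (x : 'rV[R]_n) (u : R -> 'rV[R]_n) : Prop :=
  [/\ u 0 = x,
      {within I, continuous u} &
      forall t, (interior I) t -> is_derive t (1 : R) u (g (u t))].

(* The graph of the flow: [flow f t x p y] means that the solution of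
   x' = f(x, p) starting at x exists on [0, t] and has value y at time t
   (y is unique as soon as f(., p) is continuously differentiable).  A relation
   is used because solutions may blow up in finite time. *)
Definition flow (R : realType) (n m : nat)
    (f : 'rV[R]_n -> 'rV[R]_m -> 'rV[R]_n)
    (t : R) (x : 'rV[R]_n) (p : 'rV[R]_m) (y : 'rV[R]_n) : Prop :=
  exists2 u : R -> 'rV[R]_n,
    is_solution (fun z => f z p) `[0, t] x u & u t = y.

Definition basin (R : realType) (n : nat) (g : 'rV[R]_n -> 'rV[R]_n)
    (xs : 'rV[R]_n) : set 'rV[R]_n :=
  [set x | exists2 u : R -> 'rV[R]_n,
     is_solution g `[0, +oo[ x u & u t @[t --> +oo] --> xs].

(* Fixed point, Lyapunov stable and locally attractive. *)
Definition asymptotically_stable (R : realType) (n : nat)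
    (g : 'rV[R]_n -> 'rV[R]_n) (xs : 'rV[R]_n) : Prop :=
  [/\ g xs = 0,
      forall e : R, 0 < e -> exists2 d : R, 0 < d &
        forall (x : 'rV[R]_n) (T : R) (u : R -> 'rV[R]_n),
          `|x - xs| < d -> is_solution g `[0, T] x u ->
          forall t, 0 <= t <= T -> `|u t - xs| < e &
      exists2 d : R, 0 < d &
        forall x : 'rV[R]_n, `|x - xs| < d -> basin g xs x].

(* Diagonalizability is over the complex numbers.  [jacobian] acts on row
   vectors, i.e. it is the transpose of the usual Jacobian matrix, which does
   not affect diagonalizability. *)
Definition jacobian_diagonalizable (R : realType) (n : nat)
    (g : 'rV[R]_n -> 'rV[R]_n) (xs : 'rV[R]_n) : Prop :=
  diagonalizable (map_mx (real_complex R) (jacobian g xs)).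

(* Order preservation is required at every time t >= 0 at which both
   solutions are defined. *)
Definition monotone_on (R : realType) (n m : nat)
    (f : 'rV[R]_n -> 'rV[R]_m -> 'rV[R]_n)
    (D : set 'rV[R]_n) (P : set 'rV[R]_m) : Prop :=
  forall (t : R) (x y : 'rV[R]_n) (p q : 'rV[R]_m),
    0 <= t -> D x -> D y -> P p -> P q -> vle x y -> vle p q ->
    forall x' y' : 'rV[R]_n, flow f t x p x' -> flow f t y q y' -> vle x' y'.

(* Main.v *)
(* Two facts carry the proof, for a flow that preserves the order on [D].

   A basin [B] in [D] is order-convex: if [x <= w <= y] with [x], [y] in [B] and
   [w] in [D], the orbit of [w] is squeezed between two orbits converging to the
   attractor, so [w] is in [B].  Hence a segment from [x] to a point of [[x, y]]
   meets the open set [B] exactly where it meets the closed set [D], and by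
   connectedness it stays in [B].

   An open set [U] contained in the closure of an order-convex [B] is contained
   in [B]: each point of [U] lies between two points of [B].  So [B*(q)] is
   contained in [B*(p)] as soon as it is disjoint from the basin of the other
   attractor of [p].  A common point would give, by comparing limits,
   [xb pmin <= xs p] or [xb p <= xs pmax]; in the latter case a point of the
   basin of [xb pmin] lying in one of the two basins of [p] yields
   [xb pmin <= xb p].  Either way [xb pmin <= xs pmax], which is excluded. *)
Require Import Defs.
From HB Require Import structures.
From mathcomp Require Import all_boot all_order all_algebra.
From mathcomp Require Import all_classical all_reals all_analysis.
From mathcomp.real_closed Require Import complex.
From mathcomp Require Import ring lra.

Set Implicit Arguments.
Unset Strict Implicit.
Unset Printing Implicit Defensive.

Import Order.TTheory GRing.Theory Num.Theory.
Import numFieldNormedType.Exports.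
Local Open Scope classical_set_scope.
Local Open Scope ring_scope.

(** * Rows: the sup norm and coordinatewise derivatives *)

Lemma coord_le_norm (R : realType) (n : nat) (x : 'rV[R]_n) (i : 'I_n) :
  `|x ord0 i| <= `|x|.
Proof.
by rewrite [leRHS]/Num.Def.normr/= mx_normrE; exact: (le_bigmax _ _ (ord0, i)).
Qed.

Lemma norm_le_coord (R : realType) (n : nat) (x : 'rV[R]_n) (c : R) :
  0 <= c -> (forall i, `|x ord0 i| <= c) -> `|x| <= c.
Proof.
move=> c0 xc; rewrite [leLHS]/Num.Def.normr/= mx_normrE.
by apply: bigmax_le => // -[i j] _ /=; rewrite ord1.
Qed.

Lemma is_derive_coord (R : realType) (n : nat) (u : R -> 'rV[R]_n)
    (t : R) (du : 'rV[R]_n) (i : 'I_n) :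
  is_derive t 1 u du -> is_derive t 1 (fun s => u s ord0 i) (du ord0 i).
Proof.
move=> [ud <-]; split; first exact: (derivable_mxP _ _ _).1.
by rewrite derive_mx// mxE.
Qed.

Lemma is_derive_row (R : realType) (n : nat) (u : R -> 'rV[R]_n)
    (t : R) (du : 'rV[R]_n) :
  (forall i, is_derive t 1 (fun s => u s ord0 i) (du ord0 i)) ->
  is_derive t 1 u du.
Proof.
move=> ud.
have du' : derivable u t 1 by apply/derivable_mxP => i j; rewrite ord1.
split=> //; rewrite derive_mx//; apply/rowP => i; rewrite mxE.
exact: derive_val.
Qed.

Lemma within_continuous_coord (R : realType) (n : nat) (A : set R)
    (u : R -> 'rV[R]_n) (i : 'I_n) :
  {within A, continuous u} -> {within A, continuous (fun s => u s ord0 i)}.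
Proof.
move=> uc x.
exact: (continuous_comp (uc x) (@coord_continuous R 1 n ord0 i (u x))).
Qed.

(** * Growth bounds from bounds on the derivative *)

Lemma ge0_is_derive_le (R : realType) (f df : R -> R) (a b : R) :
  a <= b -> {within `[a, b], continuous f} ->
  (forall t : R, t \in `]a, b[ -> is_derive t 1 f (df t)) ->
  (forall t : R, t \in `]a, b[ -> 0 <= df t) -> f a <= f b.
Proof.
move=> ab fc fd df0.
apply: (@ger0_derive1_le_cc R f a b) => //; rewrite ?in_itv/= ?lexx ?ab//.
- by move=> t /fd[].
- by move=> t tab; have ? := fd _ tab; rewrite derive1E derive_val df0.
Qed.

(** Both [g + f] and [g - f] have a nonnegative derivative, hence are nondecreasing; no integral is
    involved. *)
Lemma is_derive_norm_le (R : realType) (f df g dg : R -> R) (a b : R) :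
  a <= b -> {within `[a, b], continuous f} -> {within `[a, b], continuous g} ->
  (forall t : R, t \in `]a, b[ -> is_derive t 1 f (df t)) ->
  (forall t : R, t \in `]a, b[ -> is_derive t 1 g (dg t)) ->
  (forall t : R, t \in `]a, b[ -> `|df t| <= dg t) ->
  `|f b - f a| <= g b - g a.
Proof.
move=> ab fc gc fd gd fg.
have lo : g a + f a <= g b + f b.
  apply: (@ge0_is_derive_le _ (g \+ f) (dg \+ df)) => // [|t tab|t tab] /=.
  - exact: within_continuousD.
  - by apply: is_deriveD; [exact: gd | exact: fd].
  - by have := fg _ tab; rewrite ler_norml; lra.
have hi : g a - f a <= g b - f b.
  apply: (@ge0_is_derive_le _ (g \- f) (dg \- df)) => // [|t tab|t tab] /=.
  - exact: within_continuousB.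
  - by apply: is_deriveB; [exact: gd | exact: fd].
  - by have := fg _ tab; rewrite ler_norml; lra.
by rewrite ler_norml; apply/andP; split; lra.
Qed.

(** The bound on [dw] is the derivative of [A * expR (2 * L * t)], and the comparison is made in
    each coordinate. The rate is [2 * L] rather than [L] so that a field with Lipschitz constant [L]
    gains a factor 1/2 in the weight [expR (2 * L * t)]; the Gronwall and Picard arguments below
    both rest on this gain. *)
Lemma exp_growth_bound (R : realType) (n : nat) (w dw : R -> 'rV[R]_n)
    (L A T : R) :
  0 <= L -> 0 <= A -> 0 <= T -> {within `[0, T], continuous w} ->
  (forall t : R, t \in `]0, T[ -> is_derive t 1 w (dw t)) ->
  (forall t : R, t \in `]0, T[ ->
    `|dw t| <= 2 * L * A * expR (2 * L * t)) ->
  `|w T - w 0| <= A * (expR (2 * L * T) - 1).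
Proof.
move=> L0 A0 T0 wc wd dwA.
apply: norm_le_coord => [|i].
  by rewrite mulr_ge0// subr_ge0 -expR0 ler_expR !mulr_ge0.
have ed (t : R) : is_derive t 1 (fun s => A * expR (2 * L * s))
    (2 * L * A * expR (2 * L * t)).
  by apply: is_derive_eq; rewrite /GRing.scale/=; ring.
(* The [1] is written as [expR (2 * L * 0)], so that the right side is a difference of values at [T]
   and [0]. *)
rewrite !mxE mulrBr -{2}expR0 -{2}(mulr0 (2 * L)).
apply: (@is_derive_norm_le _ (fun s => w s ord0 i) (fun s => dw s ord0 i)
  (fun s => A * expR (2 * L * s)) _ _ _ T0) => //.
- exact: within_continuous_coord.
- by apply: derivable_within_continuous => t _; exact: ex_derive.
- by move=> t tT; apply: is_derive_coord; exact: wd.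
- by move=> t tT; apply: le_trans (dwA _ tT); exact: coord_le_norm.
Qed.

(** * Solutions on varying time intervals *)

Lemma is_solution_subset (R : realType) (n : nat) (g : 'rV[R]_n -> 'rV[R]_n)
    (I J : set R) (x : 'rV[R]_n) (u : R -> 'rV[R]_n) :
  J `<=` I -> is_solution g I x u -> is_solution g J x u.
Proof.
move=> JI [u0 uc ud]; split=> //; first exact: continuous_subspaceW uc.
by move=> t Jt; apply: ud; exact: (interiorS JI).
Qed.

Lemma is_solution_itv (R : realType) (n : nat) (g : 'rV[R]_n -> 'rV[R]_n)
    (T : R) (x : 'rV[R]_n) (u : R -> 'rV[R]_n) :
  is_solution g `[0, +oo[ x u -> is_solution g `[0, T] x u.
Proof.
by apply: is_solution_subset => t /=; rewrite !in_itv/= => /andP[->].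
Qed.

Lemma is_solution_itvP (R : realType) (n : nat) (g : 'rV[R]_n -> 'rV[R]_n)
    (T : R) (x : 'rV[R]_n) (u : R -> 'rV[R]_n) :
  is_solution g `[0, T] x u <->
  [/\ u 0 = x, {within `[0, T], continuous u} &
      forall t : R, t \in `]0, T[ -> is_derive t 1 u (g (u t))].
Proof.
by split=> -[u0 uc ud]; split=> // t tT; apply: ud; move: tT;
  rewrite interior_itv.
Qed.

(** Continuity and the equation at a time [t > 0] are local, so they are read off on [[0, t + 1]],
    where [t] is interior. *)
Lemma is_solution_ray (R : realType) (n : nat) (g : 'rV[R]_n -> 'rV[R]_n)
    (x : 'rV[R]_n) (u : R -> 'rV[R]_n) :
  (forall T, 0 < T -> is_solution g `[0, T] x u) ->
  is_solution g `[0, +oo[ x u.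
Proof.
move=> uT; have [u0 _ _] := uT _ ltr01; split => //.
  apply/continuous_within_itvcyP; split.
    move=> t; rewrite in_itv/= andbT => t0.
    have t1 : 0 < t + 1 by lra.
    have [_ uc _] := uT _ t1.
    have [tc _ _] := (continuous_within_itvP _ t1).1 uc.
    by apply: tc; rewrite in_itv/=; lra.
  have [_ uc _] := uT _ ltr01.
  by have [_ tc _] := (continuous_within_itvP _ ltr01).1 uc.
move=> t; rewrite interior_itv/= in_itv/= andbT => t0.
have t1 : 0 < t + 1 by lra.
have /is_solution_itvP[_ _ ud] := uT _ t1.
by apply: ud; rewrite in_itv/=; lra.
Qed.

(** Serves to pass between a field and its truncation along orbits that stay where the two agree. *)
Lemma is_solution_eq_vf (R : realType) (n : nat) (g h : 'rV[R]_n -> 'rV[R]_n)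
    (T : R) (x : 'rV[R]_n) (u : R -> 'rV[R]_n) :
  (forall t, t \in `[0, T] -> g (u t) = h (u t)) ->
  is_solution g `[0, T] x u -> is_solution h `[0, T] x u.
Proof.
move=> gh /is_solution_itvP[u0 uc ud]; apply/is_solution_itvP; split=> // t tT.
by rewrite -gh; [exact: ud|exact: subset_itv_oo_cc].
Qed.

(** * Continuous dependence on the initial point *)

Lemma within_continuous_norm (R : realType) (V : normedModType R) (A : set R)
    (u : R -> V) :
  {within A, continuous u} -> {within A, continuous (fun s => `|u s|)}.
Proof. by move=> uc x; exact: (continuous_comp (uc x) (@norm_continuous _ _ _)). Qed.

(** The weighted distance [h] attains its maximum at some [c]. Up to time [c] the growth bound
    applies with [A = h c / 2], and half of the resulting right side is absorbed on the left, which
    bounds [h c] by the initial distance. *)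
Lemma is_solution_gronwall (R : realType) (n : nat)
    (g : 'rV[R]_n -> 'rV[R]_n) (L T : R) (x y : 'rV[R]_n)
    (u v : R -> 'rV[R]_n) :
  0 <= L -> (forall a b, `|g a - g b| <= L * `|a - b|) -> 0 <= T ->
  is_solution g `[0, T] x u -> is_solution g `[0, T] y v ->
  `|u T - v T| <= 2 * `|x - y| * expR (2 * L * T).
Proof.
move=> L0 gL T0 /is_solution_itvP[u0 uc ud] /is_solution_itvP[v0 vc vd].
have dc : {within `[0, T], continuous (u \- v)} by exact: within_continuousB.
pose h (t : R) := `|u t - v t| * expR (- (2 * L * t)).
have hc : {within `[0, T], continuous h}.
  have ec : {within `[0, T], continuous (fun t : R => expR (- (2 * L * t)))}.
    by apply: derivable_within_continuous => t _; exact: ex_derive.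
  by move=> t; apply: cvgM; [exact: within_continuous_norm dc t|exact: ec].
have [c cT hmax] := EVT_max T0 hc.
have dh t : `|u t - v t| = h t * expR (2 * L * t).
  by rewrite /h /= -mulrA -expRD addNr expR0 mulr1.
have hc0 : 0 <= h c by rewrite mulr_ge0// expR_ge0.
have [c0 cT'] : 0 <= c /\ c <= T by move: cT; rewrite in_itv/= => /andP[].
have sub : `]0, c[ `<=` (`]0, T[ : set R) by apply: subset_itvl; rewrite bnd_simp.
have bound : `|(u \- v) c - (u \- v) 0| <= h c / 2 * (expR (2 * L * c) - 1).
  apply: (@exp_growth_bound _ _ _ (fun t => g (u t) - g (v t))) => //.
  - by rewrite divr_ge0.
  - by apply: continuous_subspaceW dc; apply: subset_itvl; rewrite bnd_simp.
  - by move=> t /sub tT; apply: is_deriveB; [exact: ud | exact: vd].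
  - move=> t /sub tT; apply: le_trans (gL _ _) _.
    rewrite dh (_ : 2 * L * (h c / 2) = L * h c); last by field.
    rewrite -[leRHS]mulrA ler_wpM2l// ler_wpM2r ?expR_ge0//.
    by apply: hmax; exact: subset_itv_oo_cc.
have hcle : h c <= 2 * `|x - y|.
  have : h c * expR (2 * L * c) <= `|x - y| + h c / 2 * (expR (2 * L * c) - 1).
    rewrite -dh -u0 -v0 -(subrK (u 0 - v 0) (u c - v c)).
    by rewrite (le_trans (ler_normD _ _))// addrC lerD2l.
  have e1 : 1 <= expR (2 * L * c) by rewrite -expR0 ler_expR !mulr_ge0.
  have := normr_ge0 (x - y); nra.
rewrite dh ler_wpM2r ?expR_ge0//; apply: le_trans hcle.
by apply: hmax; rewrite in_itv/= T0 lexx.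
Qed.

(** * Truncation of a vector field outside a ball *)

(** For [0 <= M], a 1-Lipschitz retraction onto the ball of radius [M]. Composing a C1 field with it
    gives a bounded, globally Lipschitz field that is unchanged on the ball; solutions then exist
    for all time, and an a priori bound shows that they solve the original equation. *)
Definition clamp (R : realType) (n : nat) (M : R) (x : 'rV[R]_n) : 'rV[R]_n :=
  \row_i Num.max (- M) (Num.min M (x ord0 i)).

Lemma clamp_norm (R : realType) (n : nat) (M : R) (x : 'rV[R]_n) :
  0 <= M -> `|clamp M x| <= M.
Proof.
move=> M0; apply: norm_le_coord => // i; rewrite mxE ler_norml le_max lexx/=.
by rewrite ge_max ge_min lexx/= andbT; lra.
Qed.

Lemma clamp_id (R : realType) (n : nat) (M : R) (x : 'rV[R]_n) :
  `|x| <= M -> clamp M x = x.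
Proof.
move=> xM; apply/rowP => i; rewrite mxE.
have := le_trans (coord_le_norm x i) xM.
by rewrite ler_norml => /andP[lo hi]; rewrite min_r// max_r.
Qed.

Lemma clamp_lipschitz (R : realType) (n : nat) (M : R) (x y : 'rV[R]_n) :
  `|clamp M x - clamp M y| <= `|x - y|.
Proof.
apply: norm_le_coord => // i; rewrite !mxE.
have := coord_le_norm (x - y) i; rewrite !mxE => /(le_trans _); apply.
by rewrite /Num.max /Num.min; do !case: ifPn; rewrite -?leNgt => *;
  rewrite ler_norml; case: (ler0P (x ord0 i - y ord0 i)) => ?;
  apply/andP; split; lra.
Qed.

Lemma is_derive_line (R : realType) (V W : normedModType R) (g : V -> W)
    (x v : V) (s : R) :
  differentiable g (x + s *: v) ->
  is_derive s (1 : R) (fun r : R => g (x + r *: v)) ('D_v g (x + s *: v)).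
Proof.
move=> gd; have gv := diff_derivable (v := v) gd.
have E : (fun h : R => h^-1 *: (((fun r : R => g (x + r *: v)) \o shift s)
    (h *: 1) - g (x + s *: v))) =
  (fun h : R => h^-1 *: ((g \o shift (x + s *: v)) (h *: v) - g (x + s *: v))).
  apply/funext => h /=; congr (_ *: (g _ - _)).
  by rewrite -[h *: 1]/(h * 1) mulr1 scalerDl addrCA.
by split; rewrite /derivable /derive E.
Qed.

Lemma derive_basis (R : realType) (n : nat) (W : normedModType R)
    (g : 'rV[R]_n -> W) (x v : 'rV[R]_n) :
  differentiable g x ->
  'D_v g x = \sum_j v ord0 j *: 'D_(delta_mx ord0 j) g x.
Proof.
move=> gd; rewrite deriveE// {1}(row_sum_delta v) linear_sum.
by apply: eq_bigr => j _; rewrite linearZ deriveE.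
Qed.

(** The partial derivatives are continuous, hence bounded on the compact ball. The mean value
    estimate is then applied along the segment from [y] to [x], which stays in the ball by
    convexity. *)
Lemma C1_lipschitz_ball (R : realType) (n : nat) (g : 'rV[R]_n -> 'rV[R]_n)
    (M : R) : 0 <= M -> C1 g ->
  exists2 L : R, 0 < L &
    forall x y, `|x| <= M -> `|y| <= M -> `|g x - g y| <= L * `|x - y|.
Proof.
move=> M0 [gd gc].
pose B := [set x : 'rV[R]_n | `|x| <= M].
have Bc : compact B.
  apply: bounded_closed_compact.
    by exists M; split; [exact: num_real|move=> N MN x /= xM; apply: le_trans xM (ltW MN)].
  exact: (closed_comp (fun x _ => @norm_continuous _ _ x) (@closed_le _ M)).
have Dbd (j : 'I_n) : exists K : R, forall x, B x ->
    `|'D_(delta_mx ord0 j) g x| <= K.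
  have B0 : B !=set0 by exists 0; rewrite /B/= normr0.
  have [|c _ cmax] := @EVT_max_rV R n
    (fun x => `|'D_(delta_mx ord0 j) g x|) B B0 Bc.
    apply: continuous_subspaceT => x.
    exact: (continuous_comp (gc _ x) (@norm_continuous _ _ _)).
  by eexists => x Bx; apply: cmax; rewrite inE; exact: Bx.
have [K KP] := choice Dbd.
(* The [1] keeps the constant positive even when the sum vanishes. *)
exists (1 + \sum_j `|K j|); first by rewrite ltr_pwDl// sumr_ge0.
move=> x y xM yM.
have seg (s : R) : s \in `]0, 1[ -> B (y + s *: (x - y)).
  rewrite in_itv/= => /andP[s0 s1]; rewrite /B/= scalerBr.
  rewrite (_ : _ + _ = (1 - s) *: y + s *: x); last first.
    by rewrite scalerBl scale1r addrAC addrA.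
  rewrite (le_trans (ler_normD _ _))// !normrZ !ger0_norm; [|lra..].
  have := normr_ge0 x; have := normr_ge0 y; nra.
apply: norm_le_coord => [|i].
  by rewrite mulr_ge0// addr_ge0// sumr_ge0.
pose C := (1 + \sum_j `|K j|) * `|x - y|.
have ld (s : R) := is_derive_line (x := y) (v := x - y) (s := s) (gd _).
have := @is_derive_norm_le R (fun s => g (y + s *: (x - y)) ord0 i)
  (fun s => 'D_(x - y) g (y + s *: (x - y)) ord0 i)
  (fun s => C * s) (fun=> C) 0 1 ler01.
rewrite scale1r scale0r addr0 subrKC mulr1 mulr0 subr0 !mxE; apply.
- apply: derivable_within_continuous => s _.
  by have [] := is_derive_coord i (ld s).
- by apply: derivable_within_continuous => s _; exact: ex_derive.
- by move=> s _; exact: is_derive_coord.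
- by move=> s _; apply: is_derive_eq; rewrite /GRing.scale/= mulr1.
- move=> s /seg sB; apply: le_trans (coord_le_norm _ _) _.
  rewrite derive_basis// (le_trans (ler_norm_sum _ _ _))//.
  apply: (@le_trans _ _ (\sum_j `|K j| * `|x - y|)); last first.
    by rewrite -mulr_suml ler_wpM2r// lerDr.
  apply: ler_sum => j _; rewrite normrZ mulrC ler_pM//.
  + by apply: le_trans (KP j _ sB) (ler_norm _).
  + exact: coord_le_norm.
Qed.

Lemma C1_clamp_lipschitz (R : realType) (n : nat) (g : 'rV[R]_n -> 'rV[R]_n)
    (M : R) : 0 <= M -> C1 g ->
  exists2 L : R, 0 < L &
    forall x y, `|g (clamp M x) - g (clamp M y)| <= L * `|x - y|.
Proof.
move=> M0 gC; have [L L0 gL] := C1_lipschitz_ball M0 gC; exists L => // x y.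
apply: le_trans (gL _ _ (clamp_norm _ M0) (clamp_norm _ M0)) _.
by rewrite ler_wpM2l ?(ltW L0)// clamp_lipschitz.
Qed.

(** * Global existence for bounded Lipschitz fields *)

(** The integral starts at [-1] rather than [0], so that the derivative at [0] is two-sided;
    subtracting its value at [0] normalizes it. *)
Lemma antiderivative (R : realType) (phi : R -> R) :
  continuous phi ->
  exists2 F : R -> R, F 0 = 0 &
    forall t : R, -1 < t -> is_derive t 1 F (phi t).
Proof.
move=> phic; pose mu := @lebesgue_measure R.
pose F (t : R) : R := (\int[mu]_(s in `[(-1 : R), t]) phi s)%R.
exists (F - cst (F 0)) => [|t t1]; first by rewrite fctE subrr.
have int : mu.-integrable `[-1, t + 1] (EFin \o phi).
  apply: continuous_compact_integrable; first exact: segment_compact.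
  exact: continuous_subspaceT.
have tt1 : t < t + 1 by lra.
have [Fd] := continuous_FTC1_closed tt1 int t1 (phic t).
rewrite derive1E => FE.
have ? : is_derive t 1 F (phi t) by split.
by apply: is_derive_eq; rewrite subr0.
Qed.

Lemma row_antiderivative (R : realType) (n : nat) (phi : R -> 'rV[R]_n)
    (x : 'rV[R]_n) :
  continuous phi ->
  exists2 F : R -> 'rV[R]_n, F 0 = x &
    forall t : R, -1 < t -> is_derive t 1 F (phi t).
Proof.
move=> phic.
have /(_ _)/cid2-/all_sig2[F F0 Fd] : forall i, exists2 F : R -> R, F 0 = 0 &
    forall t : R, -1 < t -> is_derive t 1 F (phi t ord0 i).
  move=> i; apply: (@antiderivative _ (fun t => phi t ord0 i)) => t.
  exact: (continuous_comp (phic t) (@coord_continuous R 1 n ord0 i (phi t))).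
exists (fun t => \row_i (F i t + x ord0 i)).
  by apply/rowP => i; rewrite mxE F0 add0r.
move=> t t1; apply: is_derive_row => i.
rewrite (_ : (fun s => _) = F i + cst (x ord0 i)); last first.
  by apply/funext => s; rewrite mxE.
by have ? := Fd i _ t1; apply: is_derive_eq; rewrite addr0.
Qed.

Lemma ler_geometricP (R : realType) (a b C : R) :
  (forall k, a <= b + C * 2^-1 ^+ k) -> a <= b.
Proof.
move=> H; have E : (b + C * 2^-1 ^+ k) @[k --> \oo] --> b.
  rewrite -[X in _ --> X]addr0 -(mulr0 C).
  by apply: cvgD; [exact: cvg_cst|apply: cvgMr; apply: cvg_expr;
    rewrite ger0_norm ?invr_ge0// invf_lt1//; lra].
rewrite -(cvg_lim _ E)//; apply: limr_ge; first by apply/cvg_ex; exists b.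
by apply: nearW => k; exact: H.
Qed.

Lemma geometric_cvg (R : realType) (n : nat) (u : nat -> 'rV[R]_n) (C : R) :
  (forall k, `|u k.+1 - u k| <= C * 2^-1 ^+ k) ->
  exists l, forall k, `|u k - l| <= 2 * C * 2^-1 ^+ k.
Proof.
move=> uC.
have C0 : 0 <= C by have := le_trans (normr_ge0 _) (uC 0%N); rewrite expr0 mulr1.
have p0 k : (0 : R) <= 2^-1 ^+ k by rewrite exprn_ge0// invr_ge0.
have tail k j : `|u k - u (k + j)%N| <= 2 * C * 2^-1 ^+ k.
  (* The difference of powers makes the induction on [j] close: each step adds exactly
     [C * 2^-1 ^+ (k + j)]. *)
  suff : `|u k - u (k + j)%N| <= 2 * C * (2^-1 ^+ k - 2^-1 ^+ (k + j)).
    move=> /le_trans; apply; rewrite ler_wpM2l//; first by rewrite mulr_ge0.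
    by rewrite lerBlDr lerDl.
  elim: j => [|j IH]; first by rewrite addn0 !subrr normr0 mulr0.
  rewrite addnS (le_trans (ler_distD (u (k + j)%N) _ _))//.
  rewrite [X in _ + X]distrC exprS.
  by have := uC (k + j)%N; lra.
have : cauchy (u @ \oo).
  apply: cauchy_exP => e e0.
  have E : (2 * C * 2^-1 ^+ k) @[k --> \oo] --> (0 : R).
    rewrite -(mulr0 (2 * C)); apply: cvgMr; apply: cvg_expr.
    by rewrite ger0_norm ?invr_ge0// invf_lt1//; lra.
  have [k _ kP] : \forall k \near \oo, `|2 * C * 2^-1 ^+ k| < e.
    exact: cvgr0_norm_lt E _ e0.
  exists (u k); exists k => // j /= kj.
  rewrite -ball_normE/= -(subnKC kj); apply: le_lt_trans (tail _ _) _.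
  by apply: le_lt_trans (ler_norm _) _; exact: (kP k (leqnn k)).
move=> /cauchy_cvgP/cvg_ex[l ul]; exists l => k.
have E : `|u k - u j| @[j --> \oo] --> `|u k - l|.
  by apply: cvg_norm; apply: cvgB => //; exact: cvg_cst.
rewrite -(cvg_lim _ E)//; apply: limr_le; first by apply/cvg_ex; eexists; exact: E.
by exists k => // j /= kj; rewrite -(subnKC kj).
Qed.

(** The regularity carried through the Picard iteration. It survives pointwise limits, so the limit
    is continuous without any appeal to uniform convergence; the constant [K] also fixes a time step
    in [basin_between]. *)
Definition lipschitz_ray (R : realType) (n : nat) (K : R) (u : R -> 'rV[R]_n) :=
  forall s t : R, 0 <= s -> 0 <= t -> `|u s - u t| <= K * `|s - t|.

(** Freezing [u] at [u 0] for negative times gives a function continuous on the whole line, as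
    [row_antiderivative] asks. *)
Lemma lipschitz_ray_continuous (R : realType) (n : nat) (K : R)
    (u : R -> 'rV[R]_n) :
  0 <= K -> lipschitz_ray K u -> continuous (fun t : R => u (Num.max t 0)).
Proof.
move=> K0 uK t; apply/cvgrPdist_le => e e0.
have d0 : 0 < e / (K + 1) by rewrite divr_gt0// ltr_wpDl.
near=> s.
have ts : `|t - s| <= e / (K + 1) by near: s; exact: cvgr_dist_le.
have m0 (r : R) : 0 <= Num.max r 0 by rewrite le_max lexx orbT.
apply: le_trans (uK _ _ (m0 _) (m0 _)) _.
have mm : `|Num.max t 0 - Num.max s 0| <= `|t - s|.
  rewrite /Num.max; case: ltP => ?; case: ltP => ?;
  rewrite ler_norml; case: (ler0P (t - s)) => ?; apply/andP; split; lra.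
apply: le_trans (ler_wpM2l K0 (le_trans mm ts)) _.
rewrite mulrCA ler_piMr//; first exact: ltW.
by rewrite ler_pdivrMr ?mul1r ?lerDl// ltr_wpDl.
Unshelve. all: by end_near. Qed.

(* Picard iterates, compared in the weighted distance
   [sup_t |u t - v t| exp(- 2 L t)] in which one step contracts by 1/2. *)
Lemma lipschitz_bounded_solution (R : realType) (n : nat)
    (g : 'rV[R]_n -> 'rV[R]_n) (L K : R) (x : 'rV[R]_n) :
  0 < L -> (forall a b, `|g a - g b| <= L * `|a - b|) ->
  (forall a, `|g a| <= K) ->
  exists2 u : R -> 'rV[R]_n, is_solution g `[0, +oo[ x u & lipschitz_ray K u.
Proof.
move=> L0 gL gK; have K0 : 0 <= K by exact: le_trans (normr_ge0 _) (gK 0).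
have gc : continuous g.
  move=> a; apply/(@cvgrPdist_le _ _ _ (nbhs a)) => e e0.
  have d0 : 0 < L^-1 * e by rewrite mulr_gt0// invr_gt0.
  apply: filterS (nbhsx_ballx a _ d0) => b.
  rewrite -ball_normE/= => /ltW ab.
  by apply: le_trans (gL _ _) _; rewrite -ler_pdivlMl.
have stepP (u : R -> 'rV[R]_n) : exists w : R -> 'rV[R]_n, lipschitz_ray K u ->
    [/\ w 0 = x, lipschitz_ray K w,
        forall T, {within `[0, T], continuous w} &
        forall t : R, 0 < t -> is_derive t 1 w (g (u t))].
  (* The Picard step is made total by a dummy value outside [lipschitz_ray K], so that [choice]
     yields an operator [Phi] on all functions. *)
  have [uK|] := pselect (lipschitz_ray K u); last by exists (fun=> 0).
  have uc := lipschitz_ray_continuous K0 uK.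
  have [w w0 wd] : exists2 w : R -> 'rV[R]_n, w 0 = x &
      forall t : R, -1 < t -> is_derive t 1 w (g (u (Num.max t 0))).
    apply: (@row_antiderivative _ _ (fun t => g (u (Num.max t 0)))) => t.
    exact: (continuous_comp (uc t) (gc _)).
  have wc (a b : R) : 0 <= a -> {within `[a, b], continuous w}.
    move=> a0; apply: derivable_within_continuous => t; rewrite in_itv/= => tab.
    have t1 : -1 < t by lra.
    by have [] := wd _ t1.
  exists w => _; split => // [s t|T|t t0]; last 2 first.
  - exact: wc.
  - have t1 : -1 < t by lra.
    by have := wd _ t1; rewrite max_l// ltW.
  have sym s1 t1 : 0 <= s1 -> s1 <= t1 -> `|w t1 - w s1| <= K * (t1 - s1).
    move=> s0 st; apply: norm_le_coord => [|i].
      by rewrite mulr_ge0// subr_ge0.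
    rewrite !mxE mulrBr.
    apply: (@is_derive_norm_le _ (fun s => w s ord0 i)
      (fun s => g (u (Num.max s 0)) ord0 i) (fun s => K * s) (fun=> K) _ _ st).
    - exact: within_continuous_coord (wc _ _ s0).
    - by apply: derivable_within_continuous => r _; exact: ex_derive.
    - move=> r; rewrite in_itv/= => rst; apply: is_derive_coord; apply: wd; lra.
    - by move=> r _; apply: is_derive_eq; rewrite /GRing.scale/= mulr1.
    - by move=> r _; apply: le_trans (gK _); exact: coord_le_norm.
  move=> s0 t0; have [st|/ltW ts] := leP s t.
    by rewrite distrC (distrC s) (ger0_norm (_ : 0 <= t - s)) ?subr_ge0// sym.
  by rewrite (ger0_norm (_ : 0 <= s - t)) ?subr_ge0// sym.
have [Phi PhiP] := choice stepP.
have contract A u v : lipschitz_ray K u -> lipschitz_ray K v -> 0 <= A ->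
    (forall t, 0 <= t -> `|u t - v t| <= A * expR (2 * L * t)) ->
    forall t, 0 <= t -> `|Phi u t - Phi v t| <= A / 2 * expR (2 * L * t).
  move=> /PhiP[u0 _ uc ud] /PhiP[v0 _ vc vd] A0 uv t t0.
  have : `|(Phi u \- Phi v) t - (Phi u \- Phi v) 0| <=
      A / 2 * (expR (2 * L * t) - 1).
    apply: (@exp_growth_bound _ _ _ (fun t => g (u t) - g (v t))) => //.
    - exact: ltW.
    - by rewrite divr_ge0.
    - by apply: within_continuousB; [exact: uc|exact: vc].
    - move=> s; rewrite in_itv/= => /andP[s0 _].
      by apply: is_deriveB; [exact: ud|exact: vd].
    - move=> s; rewrite in_itv/= => /andP[s0 _].
      apply: le_trans (gL _ _) _.
      rewrite (_ : 2 * L * (A / 2) = L * A); last by field.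
      by rewrite -[leRHS]mulrA ler_wpM2l ?(ltW L0)// uv// ltW.
  rewrite /= u0 v0 subrr subr0 => /le_trans; apply.
  by rewrite ler_wpM2l ?divr_ge0// lerBlDr lerDl.
pose U k := iter k Phi (fun=> x).
have UK k : lipschitz_ray K (U k).
  elim: k => [|k /PhiP[]//] s t _ _.
  by rewrite subrr normr0 mulr_ge0.
(* Chosen so that [2 * L * A = K], the bound on [g x]: this is the base case of [Ustep]. *)
pose A := K / (2 * L).
have A0 : 0 <= A by rewrite divr_ge0// mulr_ge0// ltW.
have e1 (t : R) : 0 <= t -> 1 <= expR (2 * L * t).
  by move=> t0; rewrite -expR0 ler_expR !mulr_ge0// ltW.
have Ustep k t : 0 <= t ->
    `|U k.+1 t - U k t| <= A * expR (2 * L * t) * 2^-1 ^+ k.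
  rewrite mulrAC; elim: k t => [|k IH] t t0.
    rewrite expr0 mulr1 /=; have [x0 _ xc xd] := PhiP _ (UK 0%N).
    have : `|(Phi (fun=> x) \- cst x) t - (Phi (fun=> x) \- cst x) 0| <=
        A * (expR (2 * L * t) - 1).
      apply: (@exp_growth_bound _ _ _ (fun=> g x)) => //.
      - exact: ltW.
      - apply: within_continuousB; first exact: xc.
        by apply: continuous_subspaceT => ?; exact: cvg_cst.
      - move=> s; rewrite in_itv/= => /andP[s0 _].
        by have ? := xd _ s0; apply: is_derive_eq; rewrite subr0.
      - move=> s; rewrite in_itv/= => /andP[/ltW s0 _].
        apply: le_trans (gK _) _.
        rewrite /A (_ : 2 * L * _ = K); last by field; rewrite gt_eqF.
        by rewrite ler_peMr// e1.
    rewrite /= x0 subrr subr0 => /le_trans; apply.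
    by rewrite ler_wpM2l// lerBlDr lerDl.
  have Ak : 0 <= A * 2^-1 ^+ k by rewrite mulr_ge0// exprn_ge0// invr_ge0.
  by rewrite exprSr mulrA; exact: (contract _ _ _ (UK k.+1) (UK k) Ak IH).
have lP (t : R) : exists l : 'rV[R]_n, forall k, 0 <= t ->
    `|U k t - l| <= 2 * (A * expR (2 * L * t)) * 2^-1 ^+ k.
  have [t0|] := boolP (0 <= t); last by exists 0.
  by have [l lP] := geometric_cvg (fun k => Ustep k t t0); exists l => k _.
have [l {}lP] := choice lP.
have lK : lipschitz_ray K l.
  move=> s t s0 t0.
  apply: (@ler_geometricP _ _ _ (2 * (A * expR (2 * L * s)) +
    2 * (A * expR (2 * L * t)))) => k.
  have := ler_distD (U k s) (l s) (l t).
  have := ler_distD (U k t) (U k s) (l t).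
  have := UK k s t s0 t0.
  have := lP s k s0; have := lP t k t0; rewrite (distrC (l s) (U k s)); lra.
(* Both sides are limits of [U k.+1 t]: the right one by [lP], the left one by contraction from
   [U k] and [l]. *)
have lE t : 0 <= t -> Phi l t = l t.
  move=> t0; apply/eqP; rewrite -subr_eq0 -normr_le0.
  apply: (@ler_geometricP _ _ _ (2 * (A * expR (2 * L * t)))) => k.
  rewrite add0r (le_trans (ler_distD (U k.+1 t) _ _))//.
  have p0 : (0 : R) <= 2^-1 ^+ k by rewrite exprn_ge0// invr_ge0.
  have h1 : `|U k.+1 t - l t| <= A * expR (2 * L * t) * 2^-1 ^+ k.
    by apply: le_trans (lP t _ t0) _; rewrite exprS; lra.
  suff h2 : `|Phi l t - U k.+1 t| <= A * expR (2 * L * t) * 2^-1 ^+ k by lra.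
  rewrite distrC (_ : A * _ * _ = 2 * A * 2^-1 ^+ k / 2 * expR (2 * L * t)).
    have Ak : 0 <= 2 * A * 2^-1 ^+ k by rewrite mulr_ge0// mulr_ge0.
    apply: (contract _ _ _ (UK k) lK Ak) => // s s0.
    by apply: le_trans (lP s k s0) _; lra.
  by field.
(* The solution returned is [Phi l] rather than [l]: it is differentiable by construction, with
   derivative [g (l t)], and [lE] turns this into [g (Phi l t)]. *)
have [l0 lK' lc ld] := PhiP _ lK.
exists (Phi l) => //; apply: is_solution_ray => T T0.
apply/is_solution_itvP; split => // t; rewrite in_itv/= => /andP[t0 _].
by rewrite lE ?(ltW t0)//; exact: ld.
Qed.

(** * Openness of the basins *)

Lemma cvg_rayP (R : realType) (V : normedModType R) (u : R -> V) (l : V) :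
  u t @[t --> +oo] --> l <->
  forall e, 0 < e -> exists2 T, 0 < T & forall t, T <= t -> `|u t - l| < e.
Proof.
split=> [ul e e0|H].
  have [T [_ TP]] := (cvgrPdist_lt _ _).1 ul e e0.
  exists (Num.max T 0 + 1) => [|t Tt]; first by rewrite ltr_wpDl// le_max lexx orbT.
  rewrite distrC; apply: TP; apply: lt_le_trans Tt.
  by rewrite ltr_pwDr// le_max lexx.
apply/cvgrPdist_lt => e e0; have [T T0 TP] := H _ e0.
exists T; split; first exact: num_real.
by move=> t Tt /=; rewrite distrC TP// ltW.
Qed.

(** Compactness bounds [u] on [[0, T]], and after [T] it stays within 1 of its limit. This supplies
    the truncation radii below. *)
Lemma solution_bounded (R : realType) (n : nat) (g : 'rV[R]_n -> 'rV[R]_n)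
    (x l : 'rV[R]_n) (u : R -> 'rV[R]_n) :
  is_solution g `[0, +oo[ x u -> u t @[t --> +oo] --> l ->
  exists2 M, 0 <= M & forall t, 0 <= t -> `|u t| <= M.
Proof.
move=> us /cvg_rayP /(_ 1 ltr01)[T T0 uT].
have [_ uc _] := is_solution_itv T us.
have [c _ cmax] := EVT_max (ltW T0) (within_continuous_norm uc).
exists (`|u c| + (1 + `|l|)) => [|t t0]; first by rewrite !addr_ge0.
have [tT|/ltW/uT ut] := leP t T.
  by rewrite ler_wpDr ?addr_ge0// cmax// in_itv/= t0.
rewrite ler_wpDl// -(subrK l (u t)) (le_trans (ler_normD _ _))//.
by rewrite lerD2r ltW.
Qed.

Lemma clamped_solution (R : realType) (n : nat) (g : 'rV[R]_n -> 'rV[R]_n)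
    (M : R) (x : 'rV[R]_n) :
  0 <= M -> C1 g ->
  exists2 K : R, 0 <= K & exists2 u : R -> 'rV[R]_n,
    is_solution (fun a => g (clamp M a)) `[0, +oo[ x u & lipschitz_ray K u.
Proof.
move=> M0 gC; have [L L0 gL] := C1_clamp_lipschitz M0 gC.
have [L' L'0 gL'] := C1_lipschitz_ball M0 gC.
have gK a : `|g (clamp M a)| <= L' * M + `|g 0|.
  rewrite -(subrK (g 0) (g (clamp M a))) (le_trans (ler_normD _ _))// lerD2r.
  apply: le_trans (gL' _ _ (clamp_norm _ M0) _) _; first by rewrite normr0.
  by rewrite subr0 ler_wpM2l ?(ltW L'0)// clamp_norm.
exists (L' * M + `|g 0|); first by rewrite addr_ge0// mulr_ge0// ltW.
exact: (lipschitz_bounded_solution x L0 gL gK).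
Qed.

(** As [0 < T], the shifted orbit has a two-sided derivative at its new time [0] as well, which
    settles continuity there. *)
Lemma is_solution_shift (R : realType) (n : nat) (g : 'rV[R]_n -> 'rV[R]_n)
    (T : R) (x : 'rV[R]_n) (u : R -> 'rV[R]_n) :
  0 < T -> is_solution g `[0, +oo[ x u ->
  is_solution g `[0, +oo[ (u T) (fun t => u (T + t)).
Proof.
move=> T0 us; have ud (s : R) : 0 < s -> is_derive s 1 u (g (u s)).
  move=> s0; have s1 : s < s + 1 by lra.
  have /is_solution_itvP[_ _] := is_solution_itv (s + 1) us.
  by apply; rewrite in_itv/=; lra.
have sd (s : R) : 0 <= s -> is_derive s 1 (fun t => u (T + t)) (g (u (T + s))).
  move=> s0; have Ts : 0 < T + s by lra.
  have dT : is_derive (T + s *: 1) 1 u (g (u (T + s))).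
    by rewrite -[s *: 1]/(s * 1) mulr1; exact: ud.
  have diffT : differentiable u (T + s *: 1) by apply/derivable1_diffP.
  have := is_derive_line diffT.
  rewrite derive_val (_ : (fun r => _) = (fun t => u (T + t)))//.
  by apply/funext => r; rewrite -[r *: 1]/(r * 1) mulr1.
apply: is_solution_ray => S S0; apply/is_solution_itvP; split.
- by rewrite addr0.
- apply: derivable_within_continuous => s; rewrite in_itv/= => /andP[s0 _].
  by have [] := sd _ s0.
- by move=> s; rewrite in_itv/= => /andP[/ltW s0 _]; exact: sd.
Qed.

(** The orbit of [w] is close to [l] at some time [T]. By continuous dependence, orbits of nearby
    points are also close to [l] at time [T], and from there local attraction takes over. The nearby
    orbit [h] is built for a truncated field and shown never to leave the ball of truncation. *)
Lemma basin_open (R : realType) (n : nat) (g : 'rV[R]_n -> 'rV[R]_n)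
    (l : 'rV[R]_n) :
  C1 g -> asymptotically_stable g l -> open (basin g l).
Proof.
move=> gC [_ /(_ 1 ltr01)[d1 d10 stab] [d2 d20 attr]].
rewrite openE => w [u us ul]; rewrite /interior.
have [M0 M00 uM0] := solution_bounded us ul.
(* Large enough for the three orbits met below: [u], bounded by [M0]; [h] up to time [T], within 1
   of [u]; and [v], within 1 of [l]. *)
pose M := M0 + (`|l| + 1) + 1.
have M_ge0 : 0 <= M by rewrite !addr_ge0.
have [L L0 gL] := C1_clamp_lipschitz M_ge0 gC.
pose d := Num.min d1 d2; have d0 : 0 < d by rewrite lt_min d10 d20.
have [T T0 uT] := (cvg_rayP _ _).1 ul (d / 2) ltac:(by rewrite divr_gt0).
(* Distance allowed between [h] and [u] up to [T]: the [1] keeps [h] in the ball of radius [M], the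
   [d / 2] brings [h T] within [d] of [l]. The radius [c / (2 * E)] around [w] then undoes the
   Gronwall factor. *)
pose c := Num.min 1 (d / 2); have c0 : 0 < c by rewrite lt_min ltr01 divr_gt0.
pose E := expR (2 * L * T); have E0 : 0 < E := expR_gt0 _.
have r0 : 0 < c / (2 * E) by rewrite divr_gt0// mulr_gt0.
apply: filterS (nbhsx_ballx w _ r0) => z; rewrite -ball_normE/= => wz.
have [K K0 [h hs _]] := clamped_solution z M_ge0 gC.
have clampS x v S : is_solution g `[0, S] x v ->
    (forall t, t \in `[0, S] -> `|v t| <= M) ->
    is_solution (fun a => g (clamp M a)) `[0, S] x v.
  by move=> vs vM; apply: is_solution_eq_vf vs => t /vM tM; rewrite clamp_id.
have uM t : 0 <= t -> `|u t| <= M.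
  by move=> /uM0 /le_trans; apply; rewrite /M -addrA ler_wpDr// !addr_ge0.
have hu t : 0 <= t -> t <= T -> `|h t - u t| < c.
  move=> t0 tT.
  have := is_solution_gronwall (ltW L0) gL t0 (is_solution_itv t hs)
    (clampS _ _ _ (is_solution_itv t us) _).
  have uMt s : s \in `[0, t] -> `|u s| <= M.
    by rewrite in_itv/= => /andP[s0 _]; exact: uM.
  move=> /(_ uMt) /le_lt_trans; apply.
  apply: (@le_lt_trans _ _ (2 * `|z - w| * E)).
    rewrite ler_wpM2l ?mulr_ge0// ler_expR ler_wpM2l// mulr_ge0// ltW//.
  rewrite distrC; move: wz; rewrite ltr_pdivlMr; last by rewrite mulr_gt0.
  by rewrite mulrCA mulrA.
have hTl : `|h T - l| < d.
  have := ler_distD (u T) (h T) l; have := hu T (ltW T0) (lexx _).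
  have := uT T (lexx _); rewrite /c lt_min => ? /andP[_ ?]; lra.
have [v vs vl] : basin g l (h T).
  by apply: attr; apply: lt_le_trans hTl _; rewrite ge_min lexx orbT.
(* Lyapunov stability bounds [v] by a radius that does not depend on [z], which is why [M] could be
   fixed before [z]. *)
have vM t : 0 <= t -> `|v t| <= M.
  move=> t0; have vl1 : `|v t - l| < 1.
    apply: (stab _ _ _ _ (is_solution_itv t vs)); last by rewrite t0 lexx.
    by apply: lt_le_trans hTl _; rewrite ge_min lexx.
  rewrite -(subrK l (v t)) (le_trans (ler_normD _ _))// /M.
  by have := normr_ge0 l; lra.
(* Uniqueness for the truncated field: the Gronwall bound with equal initial points. *)
have hv t : 0 <= t -> h (T + t) = v t.
  move=> t0; apply/eqP; rewrite -subr_eq0 -normr_le0.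
  have vMt s : s \in `[0, t] -> `|v s| <= M.
    by rewrite in_itv/= => /andP[s0 _]; exact: vM.
  have := is_solution_gronwall (ltW L0) gL t0
    (is_solution_itv t (is_solution_shift T0 hs))
    (clampS _ _ _ (is_solution_itv t vs) vMt).
  by rewrite subrr normr0 mulr0 mul0r.
have hM t : 0 <= t -> `|h t| <= M.
  move=> t0; have [tT|/ltW Tt] := leP t T.
    rewrite -(subrK (u t) (h t)) (le_trans (ler_normD _ _))//.
    have := hu t t0 tT; rewrite /c lt_min => /andP[? _].
    by have := uM0 t t0; have := normr_ge0 l; rewrite /M; lra.
  by rewrite -(subrKC T t) hv ?subr_ge0// vM// subr_ge0.
exists h.
  apply: is_solution_ray => S S0.
  apply: is_solution_eq_vf (is_solution_itv S hs) => t.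
  by rewrite in_itv/= => /andP[t0 _]; rewrite clamp_id// hM.
apply/cvg_rayP => e e0; have [S S0 vS] := (cvg_rayP _ _).1 vl e e0.
exists (T + S) => [|t tS]; first by rewrite addr_gt0.
by rewrite -(subrKC T t) hv ?vS//; lra.
Qed.

(** * The order on rows and squeezed orbits *)

Lemma vle_refl (R : realType) (n : nat) (x : 'rV[R]_n) : vle x x.
Proof. by move=> i. Qed.

Lemma vle_trans (R : realType) (n : nat) (x y z : 'rV[R]_n) :
  vle x y -> vle y z -> vle x z.
Proof. by move=> xy yz i; exact: le_trans (xy i) (yz i). Qed.

(** Balls of the sup norm centred at 0 are order-convex. *)
Lemma vle_norm (R : realType) (n : nat) (x y z : 'rV[R]_n) (M : R) :
  vle x y -> vle y z -> `|x| <= M -> `|z| <= M -> `|y| <= M.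
Proof.
move=> xy yz xM zM; apply: norm_le_coord => [|i].
  exact: le_trans (normr_ge0 _) xM.
have := le_trans (coord_le_norm x i) xM.
have := le_trans (coord_le_norm z i) zM.
by have := xy i; have := yz i; rewrite !ler_norml; lra.
Qed.

Lemma is_solution_flow (R : realType) (n m : nat)
    (f : 'rV[R]_n -> 'rV[R]_m -> 'rV[R]_n) (p : 'rV[R]_m) (x : 'rV[R]_n)
    (u : R -> 'rV[R]_n) (t : R) :
  is_solution (fun z => f z p) `[0, +oo[ x u -> flow f t x p (u t).
Proof. by move=> us; exists u => //; exact: is_solution_itv. Qed.

(** Orbits that start in order stay in order, and the order passes to limits in each coordinate. *)
Lemma basin_le (R : realType) (n m : nat)
    (f : 'rV[R]_n -> 'rV[R]_m -> 'rV[R]_n) (D : set 'rV[R]_n)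
    (P : set 'rV[R]_m) (p q : 'rV[R]_m) (a b x y : 'rV[R]_n) :
  monotone_on f D P -> P p -> P q -> D x -> D y -> vle p q -> vle x y ->
  basin (fun z => f z p) a x -> basin (fun z => f z q) b y -> vle a b.
Proof.
move=> fm Pp Pq Dx Dy pq xy [u us ua] [v vs vb] i.
have cc (w : R -> 'rV[R]_n) (c : 'rV[R]_n) : w t @[t --> +oo] --> c ->
    w t ord0 i @[t --> +oo] --> c ord0 i.
  by move=> wc; exact: (cvg_comp _ _ wc (@coord_continuous R 1 n ord0 i c)).
apply: ler_cvg_to (cc _ _ ua) (cc _ _ vb) _.
exists 0; split; first exact: num_real.
move=> t t0; apply: (fm t x y p q (ltW t0)) => //; exact: is_solution_flow.
Qed.

(** Monotonicity compares orbits only as long as they exist, so the orbit of [w] must first be shown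
    to be global. The candidate is a solution [h] of the field truncated at radius [M + 1], where
    [M] bounds both outer orbits. *)
Lemma basin_between (R : realType) (n m : nat)
    (f : 'rV[R]_n -> 'rV[R]_m -> 'rV[R]_n) (D : set 'rV[R]_n)
    (P : set 'rV[R]_m) (p : 'rV[R]_m) (l x y w : 'rV[R]_n) :
  C1 (fun z => f z p) -> monotone_on f D P -> P p ->
  D x -> D y -> D w -> vle x w -> vle w y ->
  basin (fun z => f z p) l x -> basin (fun z => f z p) l y ->
  basin (fun z => f z p) l w.
Proof.
move=> gC fm Pp Dx Dy Dw xw wy [u us ul] [v vs vl].
pose g z := f z p.
have [Mu Mu0 uM] := solution_bounded us ul.
have [Mv Mv0 vM] := solution_bounded vs vl.
pose M := Mu + Mv.
have M1 : 0 <= M + 1 by rewrite !addr_ge0.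
have [K K0 [h hs hK]] := clamped_solution w M1 gC.
have gs S : (forall t, t \in `[0, S] -> `|h t| <= M + 1) ->
    is_solution g `[0, S] w h.
  move=> hM; apply: is_solution_eq_vf (is_solution_itv S hs) => t tS.
  by rewrite clamp_id ?hM.
have sand t : 0 <= t -> is_solution g `[0, t] w h ->
    vle (u t) (h t) /\ vle (h t) (v t).
  move=> t0 hg; have hf : flow f t w p (h t) by exists h.
  split.
    apply: (fm t x w p p t0 _ _ _ _ _ (vle_refl _)) => //.
    exact: is_solution_flow.
  apply: (fm t w y p p t0 _ _ _ _ _ (vle_refl _)) => //.
  exact: is_solution_flow.
have sandM t : 0 <= t -> is_solution g `[0, t] w h -> `|h t| <= M.
  move=> t0 /sand[]// uh hv; apply: vle_norm uh hv _ _.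
    by apply: le_trans (uM _ t0) _; rewrite /M; lra.
  by apply: le_trans (vM _ t0) _; rewrite /M; lra.
(* [h] cannot leave the ball of radius [M + 1], being sandwiched in the ball of
   radius [M] as long as it solves the original equation. *)
pose tau := (K + 1)^-1; have tau0 : 0 < tau by rewrite invr_gt0 ltr_wpDl.
have hM k t : t \in `[0, tau *+ k] -> `|h t| <= M + 1.
  elim: k t => [|k IH] t; rewrite in_itv/= => /andP[t0 tk].
    have -> : t = 0 by apply/eqP; rewrite eq_le t0 andbT.
    have [h0 _ _] := hs; rewrite h0; apply: vle_norm xw wy _ _.
      have [<- _ _] := us; apply: le_trans (uM _ (lexx _)) _.
      by rewrite /M; lra.
    have [<- _ _] := vs; apply: le_trans (vM _ (lexx _)) _.
    by rewrite /M; lra.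
  have [/= tk'|/ltW kt] := leP t (tau *+ k); first by rewrite IH// in_itv/= t0.
  have k0 : 0 <= tau *+ k by rewrite mulrn_wge0// ltW.
  (* At time [tau *+ k] the squeeze puts [h] in the ball of radius [M]; in one more step it moves by
     at most [K * tau <= 1]. *)
  rewrite -(subrKC (h (tau *+ k)) (h t)) (le_trans (ler_normD _ _))// lerD//.
    by apply: sandM => //; exact: gs.
  apply: le_trans (hK _ _ t0 k0) _; rewrite ger0_norm ?subr_ge0//.
  have tt : t - tau *+ k <= tau by move: tk; rewrite mulrS; lra.
  apply: le_trans (ler_wpM2l K0 tt) _.
  by rewrite /tau ler_pdivrMr ?mul1r ?lerDl// ltr_wpDl.
have hg S : 0 <= S -> is_solution g `[0, S] w h.
  move=> S0; apply: gs => t; rewrite in_itv/= => /andP[t0 tS].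
  apply: (hM (Num.bound (S / tau))); rewrite in_itv/= t0/=.
  apply: le_trans tS _; rewrite -mulr_natl -ler_pdivrMr// ltW// archi_boundP//.
  by rewrite divr_ge0// ltW.
exists h; first by apply: is_solution_ray => S /ltW; exact: hg.
apply/cvg_rayP => e e0.
have [Su Su0 uS] := (cvg_rayP _ _).1 ul e e0.
have [Sv Sv0 vS] := (cvg_rayP _ _).1 vl e e0.
exists (Su + Sv) => [|t St]; first by rewrite addr_gt0.
have t0 : 0 <= t by lra.
have [uh hv] := sand _ t0 (hg _ t0).
have [uS' vS'] : `|u t - l| < e /\ `|v t - l| < e.
  by split; [apply: uS|apply: vS]; lra.
apply: (@le_lt_trans _ _ (Num.max `|u t - l| `|v t - l|)).
  apply: (@vle_norm _ _ (u t - l) _ (v t - l)) => [i|i| |].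
  - by rewrite !mxE lerD2r.
  - by rewrite !mxE lerD2r.
  - by rewrite le_max lexx.
  - by rewrite le_max lexx orbT.
by rewrite gt_max uS' vS'.
Qed.

(** * Order-convexity and its topological consequences *)

Lemma basin_order_convex (R : realType) (n m : nat)
    (f : 'rV[R]_n -> 'rV[R]_m -> 'rV[R]_n) (D : set 'rV[R]_n)
    (P : set 'rV[R]_m) (p : 'rV[R]_m) (l : 'rV[R]_n) :
  C1 (fun z => f z p) -> asymptotically_stable (fun z => f z p) l ->
  monotone_on f D P -> P p -> closed D ->
  basin (fun z => f z p) l `<=` D ->
  order_convex (basin (fun z => f z p) l).
Proof.
move=> gC st fm Pp Dcl BD x y Bx By z [xz zy].
set B := basin _ l in BD Bx By *.
pose seg (s : R) := x + s *: (z - x).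
have segc : continuous seg.
  by move=> s; apply: cvgD; [exact: cvg_cst|apply: cvgZl; exact: cvg_id].
have segE s : s \in `[0, 1] -> D (seg s) -> B (seg s).
  rewrite in_itv/= => /andP[s0 s1] Ds.
  apply: (basin_between gC fm Pp (BD _ Bx) (BD _ By) Ds _ _ Bx By) => i.
    by rewrite !mxE lerDl mulr_ge0// subr_ge0.
  by have := xz i; have := zy i; rewrite !mxE; nra.
(* The part of the segment in [B] is relatively open, and relatively closed as
   it is also the part in [D]. *)
have : `[0, 1]%classic `&` (seg @^-1` B) = `[0, 1]%classic.
  apply: (@segment_connected R 0 1).
  - by exists 0; split; rewrite /= ?in_itv/= ?lexx ?ler01// /seg scale0r addr0.
  - exists (seg @^-1` B) => //; apply: open_comp => [s _|].
      exact: segc.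
    exact: basin_open.
  - exists (seg @^-1` D); first by apply: closed_comp => // s _; exact: segc.
    by apply/seteqP; split => s [s01 /= sB]; split=> //; [exact: BD|exact: segE].
move=> /seteqP[_ /(_ 1)[]] /=.
  by rewrite in_itv/= ler01 lexx.
by rewrite /seg scale1r subrKC.
Qed.

Lemma order_convex_open_subset (R : realType) (n : nat)
    (U B : set 'rV[R]_n) :
  open U -> order_convex B -> U `<=` closure B -> U `<=` B.
Proof.
move=> Uo Bconv UB y Uy.
have [e /= e0 yU] : nbhs_ball y U by apply/nbhs_ballP; exact: open_nbhs_nbhs.
(* Moving [y] by [e / 2] up or down in every coordinate stays in [U], hence in the closure of [B]. A
   point of [B] within [e / 4] of the moved point is still on the same side of [y] in every
   coordinate. *)
have corner (c : R) : `|c| = e / 2 -> exists a, B a /\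
    forall i, y ord0 i + c - e / 4 <= a ord0 i <= y ord0 i + c + e / 4.
  move=> ce; have yc : U (y + const_mx c).
    apply: yU; rewrite -ball_normE/= opprD addNKr normrN.
    apply: (@le_lt_trans _ _ (e / 2)); last by lra.
    by apply: norm_le_coord => [|i]; rewrite ?mxE ?ce//; lra.
  have e4 : 0 < e / 4 by lra.
  have [a [Ba]] := UB _ yc _ (nbhsx_ballx _ _ e4).
  rewrite -ball_normE/= => /ltW ya; exists a; split=> // i.
  have := le_trans (coord_le_norm _ i) ya.
  by rewrite !mxE ler_norml; lra.
have [a [Ba ya]] := corner (- (e / 2)) ltac:(by rewrite normrN ger0_norm; lra).
have [b [Bb yb]] := corner (e / 2) ltac:(by rewrite ger0_norm; lra).
apply: (Bconv a b) => //; split=> i; [have := ya i|have := yb i]; lra.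
Qed.

(** Near a point of the open set [A] there are no points of [C], so [A] already lies in the closure
    of [B]. It is applied with [B] and [C] the two basins of one parameter and [A] a basin of
    another. *)
Lemma basin_subset_of_disjoint (R : realType) (n : nat)
    (A B C : set 'rV[R]_n) :
  open A -> order_convex B -> A `<=` closure (B `|` C) ->
  (forall y, A y -> ~ C y) -> A `<=` B.
Proof.
move=> Ao Bconv ABC AC; apply: order_convex_open_subset => // y Ay N Ny.
have [z [[Bz|Cz] [Nz Az]]] := ABC y Ay _ (filterI Ny (open_nbhs_nbhs (conj Ao Ay))).
  by exists z.
by have := AC _ Az.
Qed.

(** * Comparison of the basins across parameters *)

Theorem corollary1 (R : realType) (n m : nat)
    (f : 'rV[R]_n -> 'rV[R]_m -> 'rV[R]_n) (P : set 'rV[R]_m)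
    (xs xb : 'rV[R]_m -> 'rV[R]_n) (D : set 'rV[R]_n)
    (pmin pmax : 'rV[R]_m)
    (f_cont : {within [set: 'rV[R]_n] `*` P, continuous (fun z => f z.1 z.2)})
    (f_C2 : forall p, P p -> C2 (fun x => f x p))
    (xs_stable : forall p, P p -> asymptotically_stable (fun x => f x p) (xs p))
    (xb_stable : forall p, P p -> asymptotically_stable (fun x => f x p) (xb p))
    (xs_neq_xb : forall p, P p -> xs p <> xb p)
    (xs_diag : forall p, P p -> jacobian_diagonalizable (fun x => f x p) (xs p))
    (xb_diag : forall p, P p -> jacobian_diagonalizable (fun x => f x p) (xb p))
    (D_eq : forall p, P p ->
      D = closure (basin (fun x => f x p) (xs p)
                   `|` basin (fun x => f x p) (xb p)))
    (xs_in_D : forall p, P p -> D (xs p))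
    (xb_in_D : forall p, P p -> D (xb p))
    (xs_le_xb : forall p, P p -> vle (xs p) (xb p))
    (f_mono : monotone_on f D P)
    (itv_sub_P : vitv pmin pmax `<=` P)
    (xs_min_in : basin (fun x => f x pmax) (xs pmax) (xs pmin))
    (xs_max_in : basin (fun x => f x pmin) (xs pmin) (xs pmax))
    (xb_min_notin : ~ vitv (xs pmin) (xs pmax) (xb pmin)) :
  (forall p, vitv pmin pmax p ->
     basin (fun x => f x p) (xs p) `<=` basin (fun x => f x pmin) (xs pmin) /\
     basin (fun x => f x pmax) (xs pmax) `<=` basin (fun x => f x p) (xs p)) /\
  (forall p, vitv pmin pmax p ->
     order_convex (basin (fun x => f x p) (xs p))).
Proof.
have C1f p : P p -> C1 (fun z => f z p) by move=> /f_C2[].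
pose As p := basin (fun z => f z p) (xs p).
pose Ab p := basin (fun z => f z p) (xb p).
have AsD p : P p -> As p `<=` D.
  by move=> Pp x xA; rewrite (D_eq _ Pp); apply: subset_closure; left.
have AbD p : P p -> Ab p `<=` D.
  by move=> Pp x xA; rewrite (D_eq _ Pp); apply: subset_closure; right.
have As_open p : P p -> open (As p).
  by move=> Pp; apply: basin_open; [exact: C1f|exact: xs_stable].
have Ab_open p : P p -> open (Ab p).
  by move=> Pp; apply: basin_open; [exact: C1f|exact: xb_stable].
have As_convex p : P p -> order_convex (As p).
  move=> Pp; apply: (basin_order_convex (C1f _ Pp) (xs_stable _ Pp) f_mono Pp).
    by rewrite (D_eq _ Pp); exact: closed_closure.
  exact: AsD.
have stable_basin g x : asymptotically_stable g x -> basin g x x.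
  by move=> [_ _ [d d0]]; apply; rewrite subrr normr0.
split=> p [pminp ppmax]; last by apply: As_convex; exact: itv_sub_P.
have Pp : P p by exact: itv_sub_P.
have Pmin : P pmin by apply: itv_sub_P; split=> //; apply: vle_trans ppmax.
have Pmax : P pmax by apply: itv_sub_P; split=> //; apply: vle_trans ppmax.
(* Since [xs pmin] is below [xb pmin], the excluded membership amounts to this single comparison,
   which both contradictions below aim at. *)
have not_le : ~ vle (xb pmin) (xs pmax).
  by move=> ?; apply: xb_min_notin; split => //; exact: xs_le_xb.
(* One starting point under two ordered parameters: its two limits are ordered. *)
have le_of q r a b (x : 'rV[R]_n) : P q -> P r -> vle q r -> D x ->
    basin (fun z => f z q) a x -> basin (fun z => f z r) b x -> vle a b.
  by move=> Pq Pr qr Dx; apply: (basin_le f_mono Pq Pr Dx Dx qr); exact: vle_refl.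
have max_sub : As pmax `<=` As p.
  apply: (@basin_subset_of_disjoint _ _ _ _ (Ab p)).
  - exact: As_open.
  - exact: As_convex.
  - by rewrite -(D_eq _ Pp); exact: AsD.
  - move=> y ysmax ybp; apply: not_le.
    have xbp_le : vle (xb p) (xs pmax).
      exact: (le_of _ _ _ _ _ Pp Pmax ppmax (AsD _ Pmax _ ysmax) ybp ysmax).
    (* [D] is the closure of the two basins of [p], one of which therefore
       meets the open basin of [xb pmin]. *)
    have Dxb : D (xb pmin) by exact: xb_in_D.
    have Abmin : nbhs (xb pmin) (Ab pmin).
      by apply: open_nbhs_nbhs; split; [exact: Ab_open|exact/stable_basin/xb_stable].
    move: Dxb; rewrite (D_eq _ Pp) => /(_ _ Abmin)[z [zp zmin]].
    have Dz := AbD _ Pmin _ zmin.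
    apply: vle_trans xbp_le; case: zp => zp.
      apply: vle_trans (xs_le_xb _ Pp).
      exact: (le_of _ _ _ _ _ Pmin Pp pminp Dz zmin zp).
    exact: (le_of _ _ _ _ _ Pmin Pp pminp Dz zmin zp).
split=> //; apply: (@basin_subset_of_disjoint _ _ _ _ (Ab pmin)).
- exact: As_open.
- exact: As_convex.
- by rewrite -(D_eq _ Pmin); exact: AsD.
- move=> y ysp ybmin; apply: not_le.
  have smax : As pmax (xs pmax) by apply: stable_basin; exact: xs_stable.
  (* The common point [y] puts [xb pmin] below [xs p]. Then [xs p] is below [xs pmax] by starting at
     [xs pmax], which [max_sub] places in the basin of [xs p] too. *)
  apply: (@vle_trans _ _ _ (xs p)).
    exact: (le_of _ _ _ _ _ Pmin Pp pminp (AsD _ Pp _ ysp) ybmin ysp).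
  exact: (le_of _ _ _ _ _ Pp Pmax ppmax (AsD _ Pmax _ smax) (max_sub _ smax) smax).
Qed.
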